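(* Let $X$ be a non-separable zero-dimensional metrizable space, and let $\lambda$ be an infinite cardinal. Then the power $X^\lambda$ (with the product topology) is strongly homogeneous.
   Context: A topological space is zero-dimensional if it is non-empty, $\mathsf{T}_1$, and has a base consisting of clopen sets (this is small inductive dimension $\mathsf{ind}=0$; it is not assumed that the covering dimension is $0$). A topological space $Y$ is strongly homogeneous (or h-homogeneous) if every non-empty clopen subspace of $Y$ is homeomorphic to $Y$. *)

(* Defs.v *)
From mathcomp Require Import all_boot all_order all_algebra.
From mathcomp Require Import all_classical all_reals all_analysis.

Set Implicit Arguments.
Unset Strict Implicit.
Unset Printing Implicit Defensive.

Local Open Scope classical_set_scope.

Definition homeomorphic (T U : topologicalType) : Prop :=
  exists (f : T -> U) (g : U -> T),
    [/\ cancel f g, cancel g f, continuous f & continuous g].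

Definition metrizable (R : realType) (T : topologicalType) : Prop :=
  exists M : metricType R, homeomorphic T M.

Definition separable (T : topologicalType) : Prop :=
  exists2 D : set T, countable D & dense D.

(* Small inductive dimension 0. This is not the library's [zero_dimensional],
   which only asks that distinct points be separated by a clopen set. *)
Definition ind_zero (T : topologicalType) : Prop :=
  [/\ [set: T] !=set0, accessible_space T &
      exists2 B : set (set T), basis B & B `<=` @clopen T].

(* [A] used as a type is [set_type A], with the subspace topology. *)
Definition strongly_homogeneous (T : topologicalType) : Prop :=
  forall A : set T, clopen A -> A !=set0 -> homeomorphic A T.

(* Main.v *)
(* Let B be a clopen subset of X and b a point of B with a decreasing base B_n of
   clopen neighbourhoods, B_0 = B. Then X^N is homeomorphic to B x X^N. Put
   R_n = prod_(i < n) (X \ B_i) x X^N and F = prod_i (X \ B_i). The sets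
   G_n = R_n \ R_(n+1) partition the complement of F in X^N, and the sets
   Q_n = (B_n x R_n) \ (B_(n+1) x R_(n+1)) partition the complement of {b} x F in
   B x X^N. Send F to {b} x F. On G_n, exchange the n-th coordinate with the
   front: the part of G_n with z_n in B_n \ B_(n+1) goes onto
   (B_n \ B_(n+1)) x R_n, while the part with z_n in B_(n+1) goes onto the rest
   B_(n+1) x G_n of Q_n once a homeomorphism X^N = B_n x X^N is applied to the
   coordinates after n. That homeomorphism is the one under construction, for
   B_n in place of B; as every step settles at least one coordinate, this
   recursion defines a map, and likewise its inverse.

   Hence every non-empty clopen subset of X^I contains a clopen copy of X^I. Since
   X is not separable, it maps continuously onto the discrete space N, so every
   non-empty clopen A contains a discrete sequence of clopen copies of X^I;
   shifting the complement of A along these copies gives X^I = A. *)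
Require Import Defs.
From mathcomp Require Import all_boot all_order all_algebra.
From mathcomp Require Import all_classical all_reals all_analysis.

Import Order.TTheory GRing.Theory Num.Theory.
Local Open Scope classical_set_scope.

(** * Discrete families of clopen copies *)

Section LocalEquality.
Context {S T : topologicalType}.

Lemma near_eq_continuous_at (f g : S -> T) (x : S) :
  (\forall y \near x, f y = g y) -> {for x, continuous g} ->
  {for x, continuous f}.
Proof.
move=> fg cg; rewrite /prop_for /continuous_at (nbhs_singleton fg).
by apply: cvg_trans cg; apply: near_eq_cvg; apply: filterS fg.
Qed.

Lemma clopen_near {C : set S} (x : S) :
  clopen C -> \forall y \near x, C y = C x.
Proof.
move=> [oC cC]; have [Cx|nCx] := pselect (C x).
  apply: filterS (open_nbhs_nbhs (conj oC Cx)) => y Cy.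
  by apply/propext; split.
apply: filterS (open_nbhs_nbhs (conj (closed_openC cC) nCx)) => y nCy.
by apply/propext; split.
Qed.

Lemma eq_clopen (C D : set S) : (forall x, C x <-> D x) -> clopen C -> clopen D.
Proof. by move=> CD; rewrite (_ : C = D)//; apply/seteqP; split=> x /CD. Qed.

End LocalEquality.

Section ClopenEmbedding.
Context {K : topologicalType}.
Implicit Types (f g : K -> K) (A : set K).

(* For a retraction [g] of [f], the set of [x] with [f (g x) = x] is the range
   of [f]. *)
Definition clopen_embedding f g :=
  [/\ continuous f, continuous g, cancel f g & clopen [set x | f (g x) = x]].

Lemma clopen_embedding_id : clopen_embedding id id.
Proof.
split=> [x|x|//|]; [exact: cvg_id|exact: cvg_id|].
exact: (@eq_clopen _ setT _ _ clopenT).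
Qed.

(** The range of [f \o f'] consists of the points of the range of [f] that [g] sends into the range
    of [f']. *)
Lemma clopen_embedding_comp f g f' g' :
  clopen_embedding f g -> clopen_embedding f' g' ->
  clopen_embedding (f \o f') (g' \o g).
Proof.
move=> [cf cg fK cl] [cf' cg' fK' cl']; split.
- by move=> x; apply: continuous_comp; [exact: cf'|exact: cf].
- by move=> x; apply: continuous_comp; [exact: cg|exact: cg'].
- exact: can_comp.
- apply: (@eq_clopen _ ([set x | f (g x) = x] `&`
                        g @^-1` [set x | f' (g' x) = x])); last first.
    by apply: clopenI => //; apply: preimage_clopen.
  move=> x /=; split=> [[fgx ->] //|fx].
  by have gx : f' (g' (g x)) = g x by [rewrite -{2}fx fK]; rewrite -{1}gx.
Qed.

Context {A : set K} {e e' : nat -> K -> K} {psi : K -> nat}.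
Context (clA : clopen A) (ee : forall n, clopen_embedding (e n) (e' n)).
Context (eA : forall n x, A (e n x)).
Context (psi_near : forall x, \forall y \near x, psi y = psi x).
Context (psi_e : forall n x, psi (e n x) = n).

Let eK n : cancel (e n) (e' n). Proof. by have [] := ee n. Qed.

(** The union over n of the images of the complement of [A] under [e n]. As [psi] is n on the range
    of [e n], only the index [psi x] has to be tested. *)
Let E : set K := [set x | e (psi x) (e' (psi x) x) = x /\
                          ~ A (e' (psi x) x)].

Let E_near x : \forall y \near x, E y = E x.
Proof.
have clE : clopen ([set y | e (psi x) (e' (psi x) y) = y] `&`
                   e' (psi x) @^-1` (~` A)).
  have [_ ce' _ cl] := ee (psi x).
  by apply: clopenI => //; apply: preimage_clopen => //; exact: (clopenC setT).
near=> y; have -> : E y = ([set y | e (psi x) (e' (psi x) y) = y] `&`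
                   e' (psi x) @^-1` (~` A)) y.
  by rewrite /E /=; have -> : psi y = psi x by [near: y; exact: psi_near].
have -> : E x = ([set y | e (psi x) (e' (psi x) y) = y] `&`
                   e' (psi x) @^-1` (~` A)) x by [].
near: y; exact: clopen_near.
Unshelve. all: by end_near. Qed.

Let up x :=
  if `[<A x>] then
    if `[<E x>] then e (psi x).+1 (e' (psi x) x) else x
  else e 0 x.

(** Inverse to [up] on [A]: the copy of index n+1 moves back to index n, and the copy of index 0
    leaves [A]. *)
Let down x :=
  if `[<E x>] then
    if psi x is n.+1 then e n (e' n.+1 x) else e' 0 x
  else x.

Let up_A x : A (up x).
Proof.
rewrite /up; case: asboolP => [Ax|nAx]; last exact: eA.
by case: asboolP => // Ex; exact: eA.
Qed.

Let E_e n y : E (e n y) <-> ~ A y.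
Proof. by rewrite /E /= psi_e eK; split=> [[]|]. Qed.

Let upK : cancel up down.
Proof.
move=> x; rewrite /up; case: asboolP => [Ax|nAx].
  case: asboolP => [Ex|nEx]; last by rewrite /down; case: asboolP.
  rewrite /down; case: asboolP => [?|]; first by rewrite psi_e eK; case: Ex.
  by case; apply/E_e; case: Ex.
rewrite /down; case: asboolP => [?|]; first by rewrite psi_e eK.
by case; apply/E_e.
Qed.

Let downK x : A x -> up (down x) = x.
Proof.
move=> Ax; rewrite /down; case: asboolP => [|nEx]; last first.
  by rewrite /up; case: asboolP => // ?; case: asboolP.
rewrite /E/=; case Epsi: (psi x) => [|n] [ex nA]; rewrite /up.
  by case: asboolP.
case: asboolP => // ?; case: asboolP => [?|]; first by rewrite psi_e eK.
by case; apply/E_e.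
Qed.

(** Near [x] the truth values of [A] and [E] and the index [psi] are constant, so [up] agrees there
    with one of three continuous maps. *)
Let up_continuous : continuous up.
Proof.
move=> x; have An := clopen_near x clA; have En := E_near x.
have Pn := psi_near x.
have [Ax|nAx] := pselect (A x); last first.
  apply: (@near_eq_continuous_at _ _ _ (e 0)); last first.
    by have [+ _ _ _] := ee 0; apply.
  near=> y; rewrite /up; case: asboolP => // Ay.
  by have : A y = A x by [near: y]; move=> AE; move: Ay; rewrite AE.
have [Ex|nEx] := pselect (E x); last first.
  apply: (@near_eq_continuous_at _ _ _ id); last exact: cvg_id.
  near=> y; rewrite /up; case: asboolP => [?|nAy]; last first.
    by have AE : A y = A x by [near: y]; move: nAy; rewrite AE.
  case: asboolP => // Ey.
  by have EE : E y = E x by [near: y]; move: Ey; rewrite EE.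
apply: (@near_eq_continuous_at _ _ _ (e (psi x).+1 \o e' (psi x))).
  near=> y; rewrite /up; case: asboolP => [?|nAy]; last first.
    by have AE : A y = A x by [near: y]; move: nAy; rewrite AE.
  case: asboolP => [?|nEy]; first by have -> : psi y = psi x by near: y.
  by have EE : E y = E x by [near: y]; move: nEy; rewrite EE.
by apply: continuous_comp; [have [_ + _ _] := ee (psi x)
  |have [+ _ _ _] := ee (psi x).+1]; apply.
Unshelve. all: by end_near. Qed.

Let down_continuous : continuous down.
Proof.
move=> x; have En := E_near x; have Pn := psi_near x.
have [Ex|nEx] := pselect (E x); last first.
  apply: (@near_eq_continuous_at _ _ _ id); last exact: cvg_id.
  near=> y; rewrite /down; case: asboolP => // Ey.
  by have EE : E y = E x by [near: y]; move: Ey; rewrite EE.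
apply: (@near_eq_continuous_at _ _ _
    (if psi x is n.+1 then e n \o e' n.+1 else e' 0)).
  near=> y; rewrite /down; case: asboolP => [?|nEy].
    by have -> : psi y = psi x by [near: y]; case: (psi x).
  by have EE : E y = E x by [near: y]; move: nEy; rewrite EE.
case: (psi x) => [|n]; first by have [_ + _ _] := ee 0; apply.
by apply: continuous_comp; [have [_ + _ _] := ee n.+1
  |have [+ _ _ _] := ee n]; apply.
Unshelve. all: by end_near. Qed.

(* [up] shifts the complement D of A along its copies in A: D is sent to
   [e 0 @` D], which is sent to [e 1 @` D], and so on. The index [psi] makes the
   family of copies discrete, so that [up] stays continuous. *)
Lemma homeomorphic_of_clopen_copies : homeomorphic A K.
Proof.
exists (down \o set_val), (fun x => exist _ (up x) (mem_set (up_A x))); split.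
- by move=> [x Ax]; apply: val_inj => /=; apply: downK; exact: set_mem.
- by move=> x /=; exact: upK.
- move=> x; apply: continuous_comp; first exact: initial_continuous.
  exact: down_continuous.
- by apply: continuous_comp_initial; exact: up_continuous.
Qed.

End ClopenEmbedding.

(** * Absorbing a clopen factor into a countable power *)

(** The value [None] singles out the exceptional set F for [absorb], and the untouched coordinates
    for [overlay]. *)
Definition first_index (P : nat -> Prop) : option nat :=
  if pselect (exists n, P n) is left h
  then Some (ex_minn (ex_intro (fun n => `[<P n>]) _ (asboolT (projT2 (cid h)))))
  else None.

Lemma first_indexP (P : nat -> Prop) :
  (exists n, [/\ first_index P = Some n, P n & forall i, (i < n)%N -> ~ P i]) \/
  (first_index P = None /\ forall n, ~ P n).
Proof.
rewrite /first_index; case: pselect => [h|nP]; last first.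
  by right; split=> // n Pn; case: nP; exists n.
left; case: ex_minnP => n /asboolP Pn min_n; exists n; split=> // i ltin Pi.
by have := min_n i (asboolT Pi); rewrite leqNgt ltin.
Qed.

Lemma first_index_some {P : nat -> Prop} (n : nat) :
  P n -> (forall i, (i < n)%N -> ~ P i) -> first_index P = Some n.
Proof.
move=> Pn min_n; case: (first_indexP P) => [[m [-> Pm min_m]]|[_ /(_ n)]] //.
by case: (ltngtP m n) => [mn|nm|-> //]; [have := min_n m mn|have := min_m n nm].
Qed.

Lemma first_index_none {P : nat -> Prop} :
  (forall n, ~ P n) -> first_index P = None.
Proof. by move=> nP; case: (first_indexP P) => [[n [_ /nP]]|[]]. Qed.

Section Absorption.
Context {X : Type} (b : X) (B : nat -> set X).
Implicit Types (z y : nat -> X) (m n j k : nat).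

(** The first such n is the one for which z is in G_n, with B_m, B_(m+1), ... as the base. *)
Let hit m z n := B (m + n) (z n).

(* The map X^N -> B_m x X^N of the header, for the base B_m, B_(m+1), ...
   Each recursive call concerns a smaller index j, which the fuel bounds. *)
Fixpoint absorb_fuel k m z j : X :=
  if k isn't k'.+1 then b else
  if first_index (hit m z) is Some n then
    if j == 0 then z n
    else if (j <= n)%N then z j.-1
    else if `[<B (m + n).+1 (z n)>]
         then absorb_fuel k' (m + n) (fun i => z (n.+1 + i)%N) (j - n.+1)
         else z j
  else if j is j'.+1 then z j' else b.

(** A point of B_m x X^N is coded as a sequence whose entry 0 is the coordinate in B_m; entry j+1 is
    coordinate j of the other factor. *)
Definition absorb m z j := absorb_fuel j.+1 m z j.

(* The first [n] with [stop m y n] is the one for which y is in Q_n. *)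
Let stop m y n := ~ B (m + n).+1 (y 0) \/ B (m + n) (y n.+1).

Fixpoint release_fuel k m y j : X :=
  if k isn't k'.+1 then b else
  if first_index (stop m y) is Some n then
    if (j < n)%N then y j.+1
    else if j == n then y 0
    else if `[<B (m + n).+1 (y 0)>]
         then release_fuel k' (m + n) (fun i => y (n.+1 + i)%N) (j - n.+1)
         else y j
  else y j.+1.

Definition release m y j := release_fuel j.+1 m y j.

(** A recursive call spends one unit of fuel and lowers the index by at least one, so all fuels
    above j give the same value. This yields the recursion equation without fuel. *)
Lemma absorb_fuelE k m z j : (j < k)%N -> absorb_fuel k m z j = absorb m z j.
Proof.
rewrite /absorb; elim/ltn_ind: j k m z => j IH [//|k] m z jk /=.
case: first_index => // n; case: eqP => // /eqP j0; case: leqP => // ltnj.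
case: asboolP => // ?.
have lt1 : (j - n.+1 < j)%N by rewrite ltn_subrL /= lt0n j0.
by rewrite IH// ?IH// (leq_trans lt1).
Qed.

Lemma release_fuelE k m y j : (j < k)%N -> release_fuel k m y j = release m y j.
Proof.
rewrite /release; elim/ltn_ind: j k m y => j IH [//|k] m y jk /=.
case: first_index => // n; case: ltngtP => // ltnj.
case: asboolP => // ?.
have lt1 : (j - n.+1 < j)%N by rewrite ltn_subrL (leq_ltn_trans _ ltnj).
by rewrite IH// ?IH// (leq_trans lt1).
Qed.

Lemma absorbE m z j : absorb m z j =
  if first_index (hit m z) is Some n then
    if j == 0 then z n
    else if (j <= n)%N then z j.-1
    else if `[<B (m + n).+1 (z n)>]
         then absorb (m + n) (fun i => z (n.+1 + i)%N) (j - n.+1)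
         else z j
  else if j is j'.+1 then z j' else b.
Proof.
rewrite {1}/absorb /=; case: first_index => // n.
case: eqP => // /eqP j0; case: leqP => // ltnj; case: asboolP => // ?.
by rewrite absorb_fuelE // ltn_subrL /= lt0n j0.
Qed.

Lemma releaseE m y j : release m y j =
  if first_index (stop m y) is Some n then
    if (j < n)%N then y j.+1
    else if j == n then y 0
    else if `[<B (m + n).+1 (y 0)>]
         then release (m + n) (fun i => y (n.+1 + i)%N) (j - n.+1)
         else y j
  else y j.+1.
Proof.
rewrite {1}/release /=; case: first_index => // n.
case: ltngtP => // ltnj; case: asboolP => // ?.
by rewrite release_fuelE // ltn_subrL (leq_ltn_trans _ ltnj).
Qed.

Lemma absorb_none m z : (forall n, ~ B (m + n) (z n)) ->
  absorb m z = fun j => if j is j'.+1 then z j' else b.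
Proof.
move=> nB; apply/funext => j.
by rewrite absorbE (@first_index_none (hit m z)).
Qed.

Lemma absorb_some m z n : B (m + n) (z n) ->
    (forall i, (i < n)%N -> ~ B (m + i) (z i)) ->
  [/\ absorb m z 0 = z n, forall j, (j < n)%N -> absorb m z j.+1 = z j &
      forall j, absorb m z (n.+1 + j) =
        if `[<B (m + n).+1 (z n)>]
        then absorb (m + n) (fun i => z (n.+1 + i)%N) j else z (n.+1 + j)].
Proof.
move=> Bn nB; have E := @first_index_some (hit m z) n Bn nB.
split=> [|j jn|j]; rewrite [absorb m z _]absorbE E //=; first by rewrite jn.
by rewrite ltnNge leq_addr /= addKn.
Qed.

Lemma release_none m y : (forall n, B (m + n).+1 (y 0) /\ ~ B (m + n) (y n.+1)) ->
  release m y = fun j => y j.+1.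
Proof.
move=> nB; apply/funext => j; rewrite releaseE.
by rewrite (@first_index_none (stop m y)) // => n [|]; have [? ?] := nB n.
Qed.

Lemma release_some m y n : ~ B (m + n).+1 (y 0) \/ B (m + n) (y n.+1) ->
    (forall i, (i < n)%N -> B (m + i).+1 (y 0) /\ ~ B (m + i) (y i.+1)) ->
  [/\ release m y n = y 0, forall j, (j < n)%N -> release m y j = y j.+1 &
      forall j, release m y (n.+1 + j) =
        if `[<B (m + n).+1 (y 0)>]
        then release (m + n) (fun i => y (n.+1 + i)%N) j else y (n.+1 + j)].
Proof.
move=> Bn nB; have E : first_index (stop m y) = Some n.
  by apply: first_index_some => // i /nB[? ?] [].
split=> [|j jn|j]; rewrite [release m y _]releaseE E //=.
- by rewrite ltnn eqxx.
- by rewrite jn.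
by rewrite ltnNge addSn leqW ?leq_addr//= gtn_eqF ?ltnS ?leq_addr// subSS addKn.
Qed.

(** * The two maps are mutually inverse *)

Context (B_decr : forall n, B n.+1 `<=` B n) (B_b : forall n, B n b).
Context (B_sep : forall x, (forall n, B n x) -> x = b).

Lemma B_le m n : (m <= n)%N -> B n `<=` B m.
Proof.
move=> /subnKC <-; elim: (n - m)%N => [|k IH]; first by rewrite addn0.
by rewrite addnS; apply: subset_trans IH; exact: B_decr.
Qed.

Lemma absorb0 m z : B m (absorb m z 0).
Proof.
case: (first_indexP (hit m z)) => [[n [_ Bn nB]]|[_ nB]]; last first.
  by rewrite (absorb_none _ _ nB).
have [-> _ _] := absorb_some _ _ _ Bn nB.
by apply: B_le Bn; exact: leq_addr.
Qed.

(** The image of G_n lies in Q_n, so [release] stops at the very n that [absorb] used; the entries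
    after n follow by induction on j. *)
Lemma absorbK m z : release m (absorb m z) = z.
Proof.
apply/funext => j; elim/ltn_ind: j m z => j IH m z.
case: (first_indexP (hit m z)) => [[n [_ Bn nB]]|[_ nB]]; last first.
  rewrite (absorb_none _ _ nB) release_none// => n.
  by split; [exact: B_b|exact: nB].
have [E0 E1 E2] := absorb_some _ _ _ Bn nB.
have [F0 F1 F2] : [/\ release m (absorb m z) n = z n,
    forall j, (j < n)%N -> release m (absorb m z) j = absorb m z j.+1 &
    forall j, release m (absorb m z) (n.+1 + j) =
      if `[<B (m + n).+1 (z n)>]
      then release (m + n) (fun i => absorb m z (n.+1 + i)%N) j
      else absorb m z (n.+1 + j)].
  rewrite -E0; apply: release_some.
    (* If entry 0 is in B_(m+n+1), then entry n+1 starts the recursive block and hence lies in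
       B_(m+n). *)
    have [Bn1|] := pselect (B (m + n).+1 (absorb m z 0)); last by left.
    right; rewrite -[n.+1]addn0 E2; case: asboolP => [?|]; first exact: absorb0.
    by rewrite -E0.
  move=> i ltin; rewrite E0 E1//; split; last exact: nB.
  by apply: B_le Bn; rewrite -addnS leq_add2l.
have [ltjn|ltnj|->//] := ltngtP j n; first by rewrite F1// E1.
rewrite -(subnKC ltnj) F2; case: asboolP => Bn1; last first.
  by rewrite E2; case: asboolP.
have -> : (fun i => absorb m z (n.+1 + i)%N) =
    absorb (m + n) (fun i => z (n.+1 + i)%N).
  by apply/funext => i; rewrite E2; case: asboolP.
by rewrite IH// ltn_subrL (leq_ltn_trans _ ltnj).
Qed.

Lemma releaseK m y : B m (y 0) -> absorb m (release m y) = y.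
Proof.
move=> B0; apply/funext => j; elim/ltn_ind: j m y B0 => j IH m y B0.
case: (first_indexP (stop m y)) => [[n [_ Bn nB]]|[_ nB]]; last first.
  have nB' n : B (m + n).+1 (y 0) /\ ~ B (m + n) (y n.+1).
    by split; apply: contrapT => ?; apply: (nB n); [left|right; exact: contrapT].
  rewrite (release_none _ _ nB') absorb_none => [|n]; last by case: (nB' n).
  (* Without a stop, y 0 lies in every B_n, so it is b, the value that [absorb] puts at entry 0. *)
  case: j {IH} => //; apply/esym/B_sep => n.
  by apply: (@B_le n (m + n).+1); [rewrite leqW// leq_addl|case: (nB' n)].
have nB' i : (i < n)%N -> B (m + i).+1 (y 0) /\ ~ B (m + i) (y i.+1).
  move=> /nB nBi; split; apply: contrapT => ?; apply: nBi; [by left|right].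
  exact: contrapT.
have [E0 E1 E2] := release_some _ _ _ Bn nB'.
(* For n = 0 this is the hypothesis on y 0; otherwise it comes from not stopping at n-1. *)
have Bny : B (m + n) (y 0).
  case: n nB' {nB Bn E0 E1 E2} => [|n] nB'; first by rewrite addn0.
  by rewrite addnS; case: (nB' n).
have [F0 F1 F2] : [/\ absorb m (release m y) 0 = y 0,
    forall j, (j < n)%N -> absorb m (release m y) j.+1 = release m y j &
    forall j, absorb m (release m y) (n.+1 + j) =
      if `[<B (m + n).+1 (y 0)>]
      then absorb (m + n) (fun i => release m y (n.+1 + i)%N) j
      else release m y (n.+1 + j)].
  rewrite -E0; apply: absorb_some; rewrite ?E0// => i ltin.
  by rewrite E1//; case: (nB' i ltin).
case: j IH => [|j] IH; first exact: F0.
have [ltjn|lenj] := ltnP j n; first by rewrite F1// E1.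
have -> : j.+1 = (n.+1 + (j - n))%N by rewrite addSn subnKC.
rewrite F2; case: asboolP => Bn1; last by rewrite E2; case: asboolP.
have -> : (fun i => release m y (n.+1 + i)%N) =
    release (m + n) (fun i => y (n.+1 + i)%N).
  by apply/funext => i; rewrite E2; case: asboolP.
(* The induction hypothesis needs entry n+1 in B_(m+n): since y 0 is in B_(m+n+1), the stop at n can
   have no other cause. *)
rewrite IH ?ltnS ?leq_subr//= addn0.
by case: Bn.
Qed.

End Absorption.

(** * Continuity of the two maps *)

Section AbsorptionContinuity.
Context {S X : topologicalType} (b : X) (B : nat -> set X).
Context (B_clopen : forall n, clopen (B n)).
Context (B_decr : forall n, B n.+1 `<=` B n) (B_b : forall n, B n b).
Context (B_nbhs : forall U, nbhs b U -> exists n, B n `<=` U).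

Let B_near (z : S -> X) n s : continuous z ->
  \forall t \near s, B n (z t) = B n (z s).
Proof.
by move=> cz; apply: (@clopen_near _ (z @^-1` B n)); exact: preimage_clopen.
Qed.

Let near_lt (P : S -> nat -> Prop) n (s : S) :
  (forall i, (i < n)%N -> \forall t \near s, P t i) ->
  \forall t \near s, forall i, (i < n)%N -> P t i.
Proof.
elim: n => [|n IH] Pn; first by near=> t.
have Pnn := Pn n (ltnSn n).
have {}IH := IH (fun i ltin => Pn i (leqW ltin)).
near=> t => i; rewrite ltnS leq_eqVlt => /orP[/eqP->|]; first by near: t.
by move: i; near: t.
Unshelve. all: by end_near. Qed.

(** Near a point of G_n a single case of the definition applies. The parameter space [S] lets the
    induction hypothesis be used for the shifted sequence. *)
Lemma absorb_continuous m (z : S -> nat -> X) j :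
  (forall i, continuous (z ^~ i)) -> continuous (fun s => absorb b B m (z s) j).
Proof.
elim/ltn_ind: j m z => j IH m z cz s.
case: (first_indexP (fun n => B (m + n) (z s n))) => [[n [_ Bn nB]]|[_ nB]].
  have Nn := B_near (z ^~ n) (m + n) s (cz n).
  have Nn1 := B_near (z ^~ n) (m + n).+1 s (cz n).
  have Ni : \forall t \near s, forall i, (i < n)%N -> ~ B (m + i) (z t i).
    apply: near_lt => i /nB nBi.
    by apply: filterS (B_near (z ^~ i) (m + i) s (cz i)) => t ->.
  have Nz : \forall t \near s,
    [/\ absorb b B m (z t) 0 = z t n,
        forall j, (j < n)%N -> absorb b B m (z t) j.+1 = z t j &
        forall j, absorb b B m (z t) (n.+1 + j) =
          if `[<B (m + n).+1 (z s n)>]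
          then absorb b B (m + n) (fun i => z t (n.+1 + i)%N) j
          else z t (n.+1 + j)].
    near=> t; have <- : B (m + n).+1 (z t n) = B (m + n).+1 (z s n).
      by near: t.
    apply: absorb_some; last by near: t.
    by have -> : B (m + n) (z t n) = B (m + n) (z s n) by near: t.
  case: j IH => [|j] IH.
    apply: near_eq_continuous_at (cz n s).
    by apply: filterS Nz => t [].
  have [ltjn|lenj] := ltnP j n.
    apply: near_eq_continuous_at (cz j s).
    by apply: filterS Nz => t [_ + _]; apply.
  have Ej : j.+1 = (n.+1 + (j - n))%N by rewrite addSn subnKC.
  have [Bn1|nBn1] := pselect (B (m + n).+1 (z s n)).
    have ltj : (j - n < j.+1)%N by rewrite ltnS leq_subr.
    apply: near_eq_continuous_at
      (IH _ ltj (m + n) (fun t i => z t (n.+1 + i)%N) (fun i => cz _) s).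
    by apply: filterS Nz => t [_ _]; rewrite Ej => ->; case: asboolP.
  apply: near_eq_continuous_at (cz j.+1 s).
  apply: filterS Nz => t [_ _]; rewrite {1}Ej => ->.
  by case: asboolP; rewrite -?Ej.
case: j {IH} => [|j].
  (* At a point of F, entry 0 is b. Nearby points have no hit before N, so their entry 0 is b or
     lies in some B_(m+n) with n at least N; either way it is in B_N. *)
  move=> U; rewrite (absorb_none _ _ _ _ nB) => /B_nbhs[N BNU].
  have Ni : \forall t \near s, forall i, (i < N)%N -> ~ B (m + i) (z t i).
    apply: near_lt => i _; have := nB i.
    by move=> nBi; apply: filterS (B_near (z ^~ i) (m + i) s (cz i)) => t ->.
  apply: filterS Ni => t nBt; apply: BNU.
  case: (first_indexP (fun n => B (m + n) (z t n))) => [[n [_ Bn nBn]]|[_ nBn]].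
    have [-> _ _] := absorb_some b _ _ _ _ Bn nBn.
    apply: (B_le _ B_decr) (Bn); rewrite (leq_trans _ (leq_addl m n))// leqNgt.
    by apply/negP => /nBt/(_ Bn).
  by rewrite (absorb_none _ _ _ _ nBn).
apply: near_eq_continuous_at (cz j s).
have Ni : \forall t \near s, forall i, (i < j.+1)%N -> ~ B (m + i) (z t i).
  apply: near_lt => i _; have := nB i.
  by move=> nBi; apply: filterS (B_near (z ^~ i) (m + i) s (cz i)) => t ->.
apply: filterS Ni => t nBt.
case: (first_indexP (fun n => B (m + n) (z t n))) => [[n [_ Bn nBn]]|[_ nBn]].
  have [_ -> //] := absorb_some b _ _ _ _ Bn nBn.
  by rewrite ltnNge; apply/negP => lenj; exact: (nBt n).
by rewrite (absorb_none _ _ _ _ nBn).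
Unshelve. all: by end_near. Qed.

Lemma release_continuous m (y : S -> nat -> X) j :
  (forall i, continuous (y ^~ i)) -> continuous (fun s => release b B m (y s) j).
Proof.
elim/ltn_ind: j m y => j IH m y cy s.
pose stop t n := ~ B (m + n).+1 (y t 0) \/ B (m + n) (y t n.+1).
have stop_near n : \forall t \near s, stop t n = stop s n.
  have N0 := B_near (y ^~ 0) (m + n).+1 s (cy 0).
  have N1 := B_near (y ^~ n.+1) (m + n) s (cy n.+1).
  by near=> t; rewrite /stop; congr (~ _ \/ _); near: t.
have stopN t n : ~ stop t n -> B (m + n).+1 (y t 0) /\ ~ B (m + n) (y t n.+1).
  by move=> /not_orP[/contrapT].
case: (first_indexP (stop s)) => [[n [_ Bn nB]]|[_ nB]].
  have N0 := B_near (y ^~ 0) (m + n).+1 s (cy 0).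
  have Nn := stop_near n.
  have Ni : \forall t \near s, forall i, (i < n)%N -> ~ stop t i.
    by apply: near_lt => i /nB nBi; apply: filterS (stop_near i) => t ->.
  have Ny : \forall t \near s,
    [/\ release b B m (y t) n = y t 0,
        forall j, (j < n)%N -> release b B m (y t) j = y t j.+1 &
        forall j, release b B m (y t) (n.+1 + j) =
          if `[<B (m + n).+1 (y s 0)>]
          then release b B (m + n) (fun i => y t (n.+1 + i)%N) j
          else y t (n.+1 + j)].
    near=> t; have <- : B (m + n).+1 (y t 0) = B (m + n).+1 (y s 0) by near: t.
    apply: release_some => [|i ltin].
      by rewrite -/(stop t n); have -> : stop t n = stop s n by near: t.
    by apply: stopN; move: i ltin; near: t.
  have [ltjn|ltnj|->] := ltngtP j n.
  - apply: near_eq_continuous_at (cy j.+1 s).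
    by apply: filterS Ny => t [_ + _]; apply.
  - have [B0|nB0] := pselect (B (m + n).+1 (y s 0)).
      have ltj : (j - n.+1 < j)%N by rewrite ltn_subrL (leq_ltn_trans _ ltnj).
      apply: near_eq_continuous_at
        (IH _ ltj (m + n) (fun t i => y t (n.+1 + i)%N) (fun i => cy _) s).
      apply: filterS Ny => t [_ _ /(_ (j - n.+1)%N)].
      by rewrite (subnKC ltnj) => ->; case: asboolP.
    apply: near_eq_continuous_at (cy j s).
    apply: filterS Ny => t [_ _ /(_ (j - n.+1)%N)].
    by rewrite (subnKC ltnj) => ->; case: asboolP.
  - apply: near_eq_continuous_at (cy 0 s).
    by apply: filterS Ny => t [].
apply: near_eq_continuous_at (cy j.+1 s).
have Ni : \forall t \near s, forall i, (i < j.+1)%N -> ~ stop t i.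
  apply: near_lt => i _; have := nB i => nBi.
  by apply: filterS (stop_near i) => t ->.
apply: filterS Ni => t nBt.
case: (first_indexP (stop t)) => [[n [_ Bn nBn]]|[_ nBn]].
  have [_ -> //] :=
    release_some b B m (y t) n Bn (fun i ltin => stopN _ _ (nBn i ltin)).
  by rewrite ltnNge; apply/negP => lenj; exact: (nBt n).
by rewrite (release_none b B m (y t) (fun n => stopN _ _ (nBn n))).
Unshelve. all: by end_near. Qed.

End AbsorptionContinuity.

(** * Clopen copies inside a power *)

Section Power.
Context {I : pointedType} {X : topologicalType}.
Notation K := {ptws I -> X}.

Lemma ptws_cvgP (F : set_system K) (x : K) : Filter F ->
  (forall i, (fun y : K => y i) @ F --> x i) -> F --> x.
Proof.
move=> FF Fx; apply/cvg_sup => i U /=.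
rewrite (@nbhsE (initial_topology (fun f : I -> X => f i))) => -[V [[W oW <-] Wx]].
by move=> /filterS; apply; apply: Fx; exact: open_nbhs_nbhs.
Qed.

Lemma ptws_continuous {S : topologicalType} (f : S -> K) :
  (forall i, continuous (fun s => f s i)) -> continuous f.
Proof. by move=> cf s; apply: ptws_cvgP => i; exact: cf. Qed.

Lemma ptws_eval_continuous (i : I) : continuous (fun x : K => x i).
Proof. exact: (@proj_continuous I (fun=> X) i). Qed.

(** The sets containing a finite box around [x] form a filter that converges to [x] in each
    coordinate, hence in the product; so every neighbourhood of [x] belongs to it. *)
Lemma nbhs_ptws_box (x : K) (A : set K) : nbhs x A ->
  exists (l : seq I) (U : I -> set X), (forall i, nbhs (x i) (U i)) /\
    [set y : K | forall i, i \in l -> U i (y i)] `<=` A.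
Proof.
pose F : set_system K := [set A | exists (l : seq I) (U : I -> set X),
  (forall i, nbhs (x i) (U i)) /\
  [set y : K | forall i, i \in l -> U i (y i)] `<=` A].
have FF : Filter F.
  split.
  - by exists [::], (fun=> setT); split=> // i; exact: filterT.
  - move=> P Q [l [U [xU UP]]] [l' [U' [xU' UQ]]].
    exists (l ++ l'), (fun i => U i `&` U' i); split=> [i|y yU].
      exact: filterI.
    split; [apply: UP => i il|apply: UQ => i il];
      by have [] := yU i _; rewrite // mem_cat il ?orbT.
  - move=> P Q PQ [l [U [xU UP]]]; exists l, U; split=> //.
    exact: subset_trans PQ.
have : F --> x.
  apply: ptws_cvgP => i U xU; exists [:: i], (fun j => [set y | j = i -> U y]).
  split=> [j|y /(_ i)]; last by rewrite mem_head => /(_ isT) /=; exact.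
  have [->|ji] := eqVneq j i; first by apply: filterS xU => y Uy.
  by apply: filterS filterT => y _ /= /eqP; rewrite (negbTE ji).
exact.
Qed.

(** Replaces the splitting of X^I into X^N, along an injective [e], and the remaining coordinates:
    maps of X^N then act on X^I. *)
Definition overlay (e : nat -> I) (x : K) (t : nat -> X) : K :=
  fun i => if first_index (fun k => e k = i) is Some k then t k else x i.

Lemma overlay_in e x t k : injective e -> overlay e x t (e k) = t k.
Proof.
move=> inj_e; rewrite /overlay (@first_index_some _ k) // => i ltik /inj_e ik.
by rewrite ik ltnn in ltik.
Qed.

Lemma overlay_out e x t i : (forall k, e k <> i) -> overlay e x t i = x i.
Proof. by move=> ei; rewrite /overlay first_index_none. Qed.

Lemma overlay_continuous {S : topologicalType} e (x : S -> K) (t : S -> nat -> X) :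
  continuous x -> (forall k, continuous (t ^~ k)) ->
  continuous (fun s => overlay e (x s) (t s)).
Proof.
move=> cx ct; apply: ptws_continuous => i; rewrite /overlay.
case: first_index => [k|]; first exact: ct.
by move=> s; apply: (@continuous_comp _ _ _ x (fun y : K => y i));
  [exact: cx|exact: ptws_eval_continuous].
Qed.

Lemma overlay_comp e x t (f : (nat -> X) -> nat -> X) : injective e ->
  overlay e (overlay e x t) (f (overlay e x t \o e)) = overlay e x (f t).
Proof.
move=> inj_e; apply/funext => i.
have -> : overlay e x t \o e = t.
  by apply/funext => k /=; rewrite overlay_in.
by rewrite /overlay; case: first_index.
Qed.

Lemma overlay_id e x : overlay e x (x \o e) = x.
Proof.
apply/funext => i; rewrite /overlay.
by case: (first_indexP (fun k => e k = i)) => [[k [-> <-]]|[->]].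
Qed.

(** Apply [absorb] to the coordinates listed by [e]. The range is the clopen set of all [x] with
    [x (e 0)] in [B 0]. *)
Lemma clopen_embedding_coordinate (e : nat -> I) (b : X) (B : nat -> set X) :
    injective e -> (forall n, clopen (B n)) ->
    (forall n, B n.+1 `<=` B n) -> (forall n, B n b) ->
    (forall x, (forall n, B n x) -> x = b) ->
    (forall U, nbhs b U -> exists n, B n `<=` U) ->
  exists f g : K -> K, [/\ clopen_embedding f g,
    forall x, B 0 (f x (e 0)) &
    forall x i, (forall k, e k <> i) -> f x i = x i].
Proof.
move=> inj_e clB B_decr B_b B_sep B_nbhs.
pose f (x : K) := overlay e x (absorb b B 0 (x \o e)).
pose g (x : K) := overlay e x (release b B 0 (x \o e)).
have B0f x : B 0 (f x (e 0)).
  by rewrite /f overlay_in//; apply: absorb0.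
have ce k : continuous (fun x : K => (x \o e) k) by exact: ptws_eval_continuous.
exists f, g; split=> [|//|x i ei]; last exact: overlay_out.
split.
- apply: overlay_continuous => [x|k]; first exact: cvg_id.
  exact: absorb_continuous.
- apply: overlay_continuous => [x|k]; first exact: cvg_id.
  exact: release_continuous.
- by move=> x; rewrite /g /f overlay_comp// absorbK// overlay_id.
- apply: (@eq_clopen _ ((fun x : K => x (e 0)) @^-1` B 0)); last first.
    by apply: preimage_clopen => //; exact: ptws_eval_continuous.
  move=> x /=; split=> [B0|<-//].
  by rewrite /f /g overlay_comp// releaseK// overlay_id.
Qed.

Context (X_base : forall (x : X) (U : set X), nbhs x U ->
  exists B : nat -> set X,
    [/\ B 0 `<=` U, forall n, clopen (B n), forall n, B n.+1 `<=` B n &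
    [/\ forall n, B n x, forall y, (forall n, B n y) -> y = x &
        forall V, nbhs x V -> exists n, B n `<=` V]]).
Context (I_infinite : infinite_set [set: I]).

Lemma injection_avoiding (i : I) (l : seq I) : i \notin l ->
  exists e : nat -> I, [/\ injective e, e 0 = i & forall k, e k \notin l].
Proof.
move=> il.
have [h hI inj_h] : exists2 h : nat -> I,
    set_fun setT ([set: I] `\` [set` i :: l]) h & set_inj setT h.
  exact/injfunPex/pcard_leP/infiniteP/infinite_setD.
(* Avoiding [i] as well keeps the sequence injective once [i] is put in front. *)
have hP k : h k \notin i :: l by apply/negP; case: (hI k Logic.I).
exists (fun k => if k is k'.+1 then h k' else i); split=> //.
- move=> [|k] [|k'] //= E; last by rewrite (inj_h _ _ _ _ E) ?inE.
    by have := hP k'; rewrite -E inE eqxx.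
  by have := hP k; rewrite E inE eqxx.
- by case=> // k; have := hP k; rewrite inE negb_or => /andP[].
Qed.

(** One coordinate is treated at a time. The sequence used for a new [i] avoids [l], so the
    constraints already met on [l] survive. *)
Lemma clopen_embedding_box (x : K) (l : seq I) (U : I -> set X) :
  (forall i, nbhs (x i) (U i)) ->
  exists f g : K -> K, clopen_embedding f g /\
    forall y i, i \in l -> U i (f y i).
Proof.
move=> xU; elim: l => [|i l [f [g [fg fU]]]].
  by exists id, id; split=> //; exact: clopen_embedding_id.
have [il|il] := boolP (i \in l).
  by exists f, g; split=> // y j; rewrite inE => /orP[/eqP->|]; exact: fU.
have [e [inj_e e0 el]] := injection_avoiding i l il.
have [B [B0 clB Bd [Bx Bs Bn]]] := X_base (x i) (U i) (xU i).
have [f' [g' [fg' f'B f'id]]] :=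
  clopen_embedding_coordinate e (x i) B inj_e clB Bd Bx Bs Bn.
exists (f' \o f), (g \o g'); split; first exact: clopen_embedding_comp.
move=> y j; rewrite inE => /orP[/eqP->|jl].
  by apply: B0; have := f'B (f y); rewrite e0.
rewrite /= f'id; first exact: fU.
by move=> k kj; have := el k; rewrite kj jl.
Qed.

Lemma clopen_embedding_in (A : set K) : open A -> A !=set0 ->
  exists f g : K -> K, clopen_embedding f g /\ forall y, A (f y).
Proof.
move=> oA [x Ax].
have [l [U [xU UA]]] := nbhs_ptws_box x A (open_nbhs_nbhs (conj oA Ax)).
have [f [g [fg fU]]] := clopen_embedding_box x l U xU.
by exists f, g; split=> // y; apply: UA => i; exact: fU.
Qed.

Context (phi : X -> nat) (phi_near : forall x, \forall y \near x, phi y = phi x).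
Context (phi_surj : forall n, exists x, phi x = n).

Lemma power_strongly_homogeneous : strongly_homogeneous K.
Proof.
move=> A clA A0; have [oA _] := clA.
have [c [c' [cc' cA]]] := clopen_embedding_in A oA A0.
pose i : I := point.
pose V n : set K := [set y | phi (y i) = n].
have near_phi (y : K) : \forall z \near y, phi (z i) = phi (y i).
  exact: (ptws_eval_continuous i y _ (phi_near (y i))).
have oV n : open (V n).
  rewrite openE => y Vy.
  apply: (@filterS _ _ (nbhs_filter y) _ _ _ (near_phi y)) => z.
  rewrite /V/= => ->; exact: Vy.
have V0 n : V n !=set0 by have [x xn] := phi_surj n; exists (fun=> x).
have /choice[f /choice[f' ff']] n := clopen_embedding_in (V n) (oV n) (V0 n).
have [_ cc'c c'K _] := cc'.
(* The copies are discrete because the index of a point is read off after undoing [c]: on the n-th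
   copy, coordinate [i] then has [phi] equal to n. *)
apply: (@homeomorphic_of_clopen_copies _ A (fun n => c \o f n)
  (fun n => f' n \o c') (fun y => phi (c' y i))) => //.
- by move=> n; apply: clopen_embedding_comp => //; case: (ff' n).
- by move=> n y; exact: cA.
- by move=> y; exact: (cc'c y _ (near_phi (c' y))).
- by move=> n y /=; rewrite c'K; case: (ff' n) => _; exact.
Qed.

End Power.

(** * Non-separable metrizable spaces *)

Section Metrizable.
Context {R : realType} {X : topologicalType} {M : metricType R}.
Context {f : X -> M} {g : M -> X}.
Context (fK : cancel f g) (cf : continuous f) (cg : continuous g).
Context (X_T1 : accessible_space X) {C : set (set X)}.
Context (C_basis : basis C) (C_clopen : C `<=` @clopen X).
Implicit Types (x y : X) (U : set X).

Let nbhs_ball x (r : R) : (0 < r)%R -> nbhs x (f @^-1` ball (f x) r).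
Proof. by move=> r0; apply: cf; exact: nbhsx_ballx. Qed.

Let ball_sub x U : nbhs x U ->
  exists n : nat, f @^-1` ball (f x) (n.+1%:R^-1)%R `<=` U.
Proof.
rewrite -{1}(fK x) => /cg /nbhs_ballP[r /= r0 rU].
have [n _ nr] := near_infty_natSinv_lt (PosNum r0).
exists n => y /= xy; rewrite -(fK y); apply: rU.
by apply: le_ball xy; apply/ltW; exact: (nr n (leqnn n)).
Qed.

Let clopen_sub x U : nbhs x U -> exists V, [/\ clopen V, V x & V `<=` U].
Proof.
by move=> /(C_basis.2 x)[V [CV Vx] VU]; exists V; split=> //; exact: C_clopen.
Qed.

Lemma clopen_nbhs_sequence x U : nbhs x U ->
  exists B : nat -> set X,
    [/\ B 0 `<=` U, forall n, clopen (B n), forall n, B n.+1 `<=` B n &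
    [/\ forall n, B n x, forall y, (forall n, B n y) -> y = x &
        forall V, nbhs x V -> exists n, B n `<=` V]].
Proof.
move=> /clopen_sub[B0 [clB0 B0x B0U]].
have /choice[D DP] (n : nat) : exists V, [/\ clopen V, V x &
    V `<=` f @^-1` ball (f x) (n.+1%:R^-1)%R].
  by apply/clopen_sub/nbhs_ball; rewrite invr_gt0.
(* Intersecting makes the sequence decrease; [D n] enters at stage n+1, after the initial set inside
   [U]. *)
pose B := fix B n := if n is n'.+1 then B n' `&` D n' else B0.
have B_nbhs V : nbhs x V -> exists n, B n `<=` V.
  move=> /ball_sub[n nV]; exists n.+1 => y [_ Dy].
  by have [_ _ DV] := DP n; apply/nV/DV.
have Bx n : B n x by elim: n => //= n Bn; split=> //; case: (DP n).
exists B; split=> //.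
- by elim=> //= n clBn; apply: clopenI => //; case: (DP n).
- by move=> n y [].
split=> // y By; apply: contrapT => /eqP yx.
have [A [oA Ax Ay]] : exists A, [/\ open A, x \in A & y \in ~` A].
  by apply: X_T1; rewrite eq_sym.
have [n BnA] := B_nbhs A (open_nbhs_nbhs (conj oA (set_mem Ax))).
by apply: (set_mem Ay); exact: BnA.
Qed.

(** * A continuous surjection onto the discrete natural numbers *)

Context (X_nonseparable : ~ separable X).

(** Otherwise finite nets for all radii 1/(n+1) would have a countable dense union. *)
Lemma not_totally_bounded : exists2 r : R, (0 < r)%R & forall l : seq X,
  exists x, forall y, y \in l -> ~ ball (f y) r (f x).
Proof.
apply: contrapT => nr; apply: X_nonseparable.
have /choice[l lP] (n : nat) : exists l : seq X, forall x,
    exists2 y, y \in l & ball (f y) (n.+1%:R^-1)%R (f x).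
  apply: contrapT => nl; apply: nr; exists (n.+1%:R^-1)%R.
    by rewrite invr_gt0.
  move=> l; apply: contrapT => nx; apply: nl; exists l => x.
  apply: contrapT => ny; apply: nx; exists x => y yl xy; apply: ny.
  by exists y.
exists (\bigcup_n [set` l n]).
  by apply: bigcup_countable => // n _; apply: finite_set_countable.
move=> O [x Ox] oO; have [n nO] := ball_sub x O (open_nbhs_nbhs (conj oO Ox)).
have [y yl xy] := lP n x.
by exists y; split; [apply: nO; apply: ball_sym|exists n].
Qed.

(** Clopen sets [V n] of radius r/4 around an r-separated sequence form a discrete family: a ball of
    radius r/8 meets at most one of them. *)
Lemma locally_constant_surjection : exists2 phi : X -> nat,
  forall x, \forall y \near x, phi y = phi x & forall n, exists x, phi x = n.
Proof.
have [r r0 /choice[next nextP]] := not_totally_bounded.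
(* Greedy choice: [L n] lists the first n points, and [u n] lies outside their r-balls. *)
pose L := fix L n := if n is n'.+1 then next (L n') :: L n' else [::].
pose u n := next (L n).
have uL m n : (m < n)%N -> u m \in L n.
  elim: n => // n IH; rewrite ltnS leq_eqVlt => /orP[/eqP->|/IH mn].
    exact: mem_head.
  by rewrite inE mn orbT.
have u_sep m n : ball (f (u m)) r (f (u n)) -> m = n.
  move=> mn; have [ltmn|ltnm|//] := ltngtP m n.
    by have := nextP (L n) (u m) (uL _ _ ltmn).
  by have := nextP (L m) (u n) (uL _ _ ltnm); case; exact: ball_sym.
have /choice[V VP] (n : nat) : exists V, [/\ clopen V, V (u n) &
    V `<=` f @^-1` ball (f (u n)) (r / 2 / 2)%R].
  by apply/clopen_sub/nbhs_ball; rewrite !divr_gt0.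
have V_sep x y z m n : ball (f x) (r / 2 / 2 / 2)%R (f y) ->
    ball (f x) (r / 2 / 2 / 2)%R (f z) -> V m y -> V n z -> m = n.
  move=> xy xz Vy Vz; apply: u_sep.
  have [_ _ /(_ _ Vy) /= my] := VP m; have [_ _ /(_ _ Vz) /= nz] := VP n.
  have yz : ball (f y) (r / 2 / 2)%R (f z).
    by rewrite [X in ball _ X]splitr; apply: ball_triangle xz; exact: ball_sym.
  have mz : ball (f (u m)) (r / 2)%R (f z).
    by rewrite [X in ball _ X]splitr; apply: ball_triangle yz.
  rewrite [X in ball _ X]splitr; apply: ball_triangle mz _.
  apply: ball_sym; apply: le_ball nz.
  by rewrite ler_pdivrMr// ler_peMr// ?divr_ge0 ?ltW// ltr1n.
(* The default 0 merges the complement of the family with [V 0], which keeps [phi] locally constant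
   and onto. *)
pose phi x := if first_index (V^~ x) is Some n then n else 0.
have phiE x n : V n x -> (forall m, V m x -> m = n) -> phi x = n.
  move=> Vx Vu; rewrite /phi (@first_index_some _ n) // => i ltin /Vu E.
  by rewrite E ltnn in ltin.
have r8 : (0 < r / 2 / 2 / 2)%R by rewrite !divr_gt0.
exists phi => [x|n].
  have Ox := nbhs_ball x _ r8.
  have [[y [n [xy Vy]]]|nV] := pselect (exists y n,
      ball (f x) (r / 2 / 2 / 2)%R (f y) /\ V n y).
    have phi_ball z : ball (f x) (r / 2 / 2 / 2)%R (f z) ->
        phi z = if `[<V n z>] then n else 0.
      move=> xz; case: asboolP => Vz.
        by apply: phiE => // m Vm; exact: (V_sep x z y).
      rewrite /phi; case: (first_indexP (V^~ z)) => [[m [-> Vm _]]|[->]//].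
      by case: Vz; rewrite -(V_sep x z y m n).
    have [clVn _ _] := VP n.
    near=> z; rewrite !phi_ball; last 2 first.
    - exact: ballxx.
    - by near: z.
    have -> // : V n z = V n x.
    by near: z; exact: clopen_near.
  have phi0 z : ball (f x) (r / 2 / 2 / 2)%R (f z) -> phi z = 0.
    move=> xz; rewrite /phi first_index_none// => n Vn.
    by apply: nV; exists z, n.
  by near=> z; rewrite !phi0//; [exact: ballxx|near: z].
have [_ Vu _] := VP n; exists (u n); apply: phiE => // m Vm.
by apply: (V_sep (u n) (u n) (u n)) => //; exact: ballxx.
Unshelve. all: by end_near. Qed.

End Metrizable.

(* The infinite cardinal is the cardinality of the index type I. *)
Theorem theorem3p1 (R : realType) (X : topologicalType) (I : Type)
    (X_metrizable : metrizable R X) (X_zero_dim : ind_zero X)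
    (X_nonseparable : ~ separable X) (I_infinite : infinite_set [set: I]) :
  strongly_homogeneous {ptws I -> X}.
Proof.
(* An infinite index type has a point, which serves as the coordinate read by [phi]. *)
elim/Ppointed: I => I in I_infinite *.
  by case: I_infinite; rewrite emptyE.
have [M [f [g [fK _ cf cg]]]] := X_metrizable.
have [_ X_T1 [C C_basis C_clopen]] := X_zero_dim.
have [phi phi_near phi_surj] :=
  locally_constant_surjection fK cf cg C_basis C_clopen X_nonseparable.
apply: (power_strongly_homogeneous _ I_infinite phi) => // x U.
exact: (clopen_nbhs_sequence fK cf cg X_T1 C_basis C_clopen).
Qed.
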